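(* Let $\mathcal{V}\subset\mathbb{F}_q^d$ be a regular variety. Then the Cayley digraph $C_\mathcal{V}$ is a $(q^d,|\mathcal{V}|,cq^{(d-1)/2})$-digraph for some positive constant $c$ (independent of $q$).
   Context: Let $\chi$ be a fixed nontrivial additive character of $\mathbb{F}_q$, and $\widehat{\mathbf{1}_\mathcal{V}}(\mathbf{m})=q^{-d}\sum_{\mathbf{x}\in\mathbb{F}_q^d}\chi(-\mathbf{m}\cdot\mathbf{x})\mathbf{1}_\mathcal{V}(\mathbf{x})$. A variety $\mathcal{V}=\{\mathbf{x}\in\mathbb{F}_q^d : F(\mathbf{x})=0\}$ ($F$ a polynomial over $\mathbb{F}_q$) is regular if $|\mathcal{V}|\asymp q^{d-1}$ and $|\widehat{\mathbf{1}_\mathcal{V}}(\mathbf{m})|\ll q^{-(d+1)/2}$ for all $\mathbf{m}\neq\mathbf{0}$, with implied constants independent of $q$ ($\mathcal{V}$ depends on $q$, $d$ fixed). The Cayley digraph $C_\mathcal{V}$ has vertex set $\mathbb{F}_q^d$ and a directed edge from $\mathbf{x}$ to $\mathbf{y}$ iff $\mathbf{y}-\mathbf{x}\in\mathcal{V}$. For a digraph $G$ on $n$ vertices in which every vertex has in-degree and out-degree $D$, with adjacency matrix $A_G$ ($a_{ij}=1$ iff there is an edge from $i$ to $j$) and complex eigenvalues $\lambda_1=D,\lambda_2,\ldots,\lambda_n$, set $\lambda(G)=\max_{|\lambda_i|\neq D}|\lambda_i|$. $G$ is an $(n,D,\lambda)$-digraph if it is $D$-regular in this sense, $A_G$ is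 normal ($A_G^tA_G=A_GA_G^t$), and $\lambda(G)\le\lambda$. *)

(* Defs.v *)
From HB Require Import structures.
From mathcomp Require Import all_boot all_order all_algebra.
From mathcomp Require Import reals exp.
From mathcomp Require Import complex.
(* Not imported: the notations of mpoly clash with those of exp. *)
From mathcomp Require mpoly.

Set Implicit Arguments.
Unset Strict Implicit.
Unset Printing Implicit Defensive.

Import Order.TTheory GRing.Theory Num.Theory.

Local Open Scope ring_scope.
Local Open Scope complex_scope.

(* The real-valued modulus; the norm `|z| of MathComp lives in R[i]. *)
Definition modulus (R : realType) (z : R[i]) : R := ComplexField.Normc.normc z.

Definition nontrivial_additive_character (R : realType) (F : finFieldType)
    (chi : F -> R[i]) : Prop :=
  [/\ chi 0 = 1, forall a b, chi (a + b) = chi a * chi b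
    & exists a, chi a != 1].

Section FiniteFieldVarieties.
Variables (R : realType) (F : finFieldType) (d : nat).

Definition dot (m x : 'rV[F]_d) : F := \sum_i m 0 i * x 0 i.

Definition variety (P : mpoly.mpoly d F) : {set 'rV[F]_d} :=
  [set x : 'rV[F]_d | mpoly.meval (fun i => x 0 i) P == 0].

Definition fourier_indicator (chi : F -> R[i]) (V : {set 'rV[F]_d})
    (m : 'rV[F]_d) : R[i] :=
  (#|F|%:R ^+ d)^-1 * \sum_(x : 'rV[F]_d) chi (- dot m x) * (x \in V)%:R.

(* a, b are the implied constants in |V| \asymp q^(d-1), and C the one in
   the Fourier bound. *)
Definition regular_variety (a b C : R) (chi : F -> R[i])
    (V : {set 'rV[F]_d}) : Prop :=
  [/\ a * #|F|%:R `^ (d%:R - 1) <= #|V|%:R,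
      #|V|%:R <= b * #|F|%:R `^ (d%:R - 1)
    & forall m : 'rV[F]_d, m != 0 ->
        modulus (fourier_indicator chi V m)
          <= C * #|F|%:R `^ (- ((d%:R + 1) / 2))].

Definition cayley_digraph (V : {set 'rV[F]_d}) : rel 'rV[F]_d :=
  [rel x y | y - x \in V].

End FiniteFieldVarieties.

Section Digraphs.
Variables (R : realType) (T : finType) (e : rel T).

Definition adjacency_mx : 'M[R[i]]_#|T| :=
  \matrix_(i, j) (e (enum_val i) (enum_val j))%:R.

Definition regular_digraph (D : nat) : Prop :=
  forall x, #|[set y | e x y]| = D /\ #|[set y | e y x]| = D.

(* All complex eigenvalues, listed with multiplicity: the roots of the (monic)
   characteristic polynomial. *)
Definition eigenvalues : seq R[i] :=
  sval (closed_field_poly_normal (char_poly adjacency_mx)).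

(* 0 if all eigenvalues have modulus D. *)
Definition digraph_lambda (D : nat) : R :=
  \big[Num.max/0]_(z <- eigenvalues | modulus z != D%:R) modulus z.

Definition nDl_digraph (n D : nat) (lam : R) : Prop :=
  [/\ #|T| = n,
      regular_digraph D,
      adjacency_mx^T *m adjacency_mx = adjacency_mx *m adjacency_mx^T
    & digraph_lambda D <= lam].

End Digraphs.

(* Main.v *)
(* The additive characters [x |-> chi (dot m x)] diagonalize every Cayley
   digraph on F_q^d: taking the Fourier transform of [v A = z v] gives
   [(z - lambda_m) v^(m) = 0] where [lambda_m] is the sum of the m-th character
   over V.  By Fourier inversion [v^(m) != 0] for some m, so [z = lambda_m];
   this is |V| if m = 0, and q^d times a Fourier coefficient of V otherwise. *)
Require Import Defs.
From mathcomp Require Import all_boot all_order all_algebra.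
From mathcomp Require Import reals exp.
From mathcomp Require Import complex.
From mathcomp Require mpoly.

Set Implicit Arguments.
Unset Strict Implicit.
Unset Printing Implicit Defensive.

Import Order.TTheory GRing.Theory Num.Theory.
Local Open Scope ring_scope.

Lemma sum_enum_val (K : nmodType) (T : finType) (f : T -> K) :
  \sum_x f x = \sum_(i < #|T|) f (enum_val i).
Proof. exact/reindex/onW_bij/enum_val_bij. Qed.

Section Dot.
Variables (F : finFieldType) (d : nat).
Implicit Types m x y : 'rV[F]_d.

Lemma dot0v x : dot 0 x = 0.
Proof. by rewrite /dot big1 // => i _; rewrite mxE mul0r. Qed.

Lemma dotv0 m : dot m 0 = 0.
Proof. by rewrite /dot big1 // => i _; rewrite mxE mulr0. Qed.

Lemma dotDl m n x : dot (m + n) x = dot m x + dot n x.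
Proof.
by rewrite /dot -big_split; apply: eq_bigr => i _; rewrite mxE mulrDl.
Qed.

Lemma dotDr m x y : dot m (x + y) = dot m x + dot m y.
Proof.
by rewrite /dot -big_split; apply: eq_bigr => i _; rewrite mxE mulrDr.
Qed.

Lemma dotNl m x : dot (- m) x = - dot m x.
Proof. by rewrite /dot -sumrN; apply: eq_bigr => i _; rewrite mxE mulNr. Qed.

(** One nonzero coordinate of [x] suffices: [m] is supported there. This yields a frequency at which
    a nontrivial character differs from 1. *)
Lemma dot_onto x (c : F) : x != 0 -> exists m, dot m x = c.
Proof.
case/rV0Pn => i xi_neq0; exists (\row_j (if j == i then c / x 0 i else 0)).
rewrite /dot (bigD1 i) //= big1 => [|j /negPf ji]; rewrite mxE ?ji ?mul0r //.
by rewrite eqxx addr0 divfK.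
Qed.

End Dot.

Section Fourier.
Variables (R : realType) (F : finFieldType) (d : nat) (chi : F -> R[i]).
Hypothesis chi_char : nontrivial_additive_character chi.
Implicit Types m x : 'rV[F]_d.

(** Orthogonality of characters: for [x != 0], shifting [m] by some [n] with [chi (dot n x) != 1]
    multiplies the sum by that value, so the sum vanishes. *)
Lemma sum_character x :
  \sum_(m : 'rV[F]_d) chi (dot m x) = if x == 0 then #|F|%:R ^+ d else 0.
Proof.
have [chi0 chiD [c chi_c]] := chi_char.
case: eqVneq => [->|/(@dot_onto _ _ _ c)[n dot_n]].
  under eq_bigr do rewrite dotv0 chi0.
  by rewrite sumr_const card_mx mul1n natrX.
set S := \sum_m _; have : S = chi c * S.
  rewrite {1}/S (reindex_inj (addrI n)) /S mulr_sumr.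
  by apply: eq_bigr => m _; rewrite dotDl chiD dot_n.
move/eqP; rewrite -subr_eq0 -[X in X - _]mul1r -mulrBl mulf_eq0 subr_eq0.
by rewrite eq_sym (negPf chi_c) => /eqP.
Qed.

(** After exchanging the sums, [f y] has coefficient [\sum_m chi (dot m (y - x))], which by
    orthogonality survives only at [y = x]. *)
Lemma fourier_inversion (f : 'rV[F]_d -> R[i]) x :
  \sum_m chi (- dot m x) * \sum_y f y * chi (dot m y) = #|F|%:R ^+ d * f x.
Proof.
have [_ chiD _] := chi_char.
under eq_bigr do rewrite mulr_sumr.
rewrite exchange_big (bigD1 x) //= [X in _ + X]big1 => [|y y_neq_x].
  under eq_bigr => m _ do rewrite mulrCA -chiD addNr -(dotv0 m).
  by rewrite -mulr_sumr sum_character eqxx addr0 mulrC.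
have dotB m : - dot m x + dot m y = dot m (y - x).
  by rewrite dotDr addrC; congr (_ + _); apply/eqP;
     rewrite eq_sym -addr_eq0 -dotDr addNr dotv0.
under eq_bigr => m _ do rewrite mulrCA -chiD dotB.
by rewrite -mulr_sumr sum_character subr_eq0 (negPf y_neq_x) mulr0.
Qed.

(** The frequency is [- m] because the Fourier coefficient carries a minus sign inside [chi]. *)
Lemma fourier_indicatorE (V : {set 'rV[F]_d}) m :
  \sum_(t in V) chi (dot m t) = #|F|%:R ^+ d * fourier_indicator chi V (- m).
Proof.
have q_neq0 : #|F|%:R ^+ d != 0 :> R[i].
  by rewrite expf_neq0 // pnatr_eq0 -lt0n; apply/card_gt0P; exists 0.
rewrite /fourier_indicator mulVKf // big_mkcond /=.
apply: eq_bigr => t _; rewrite dotNl opprK.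
by case: (t \in V); rewrite (mulr1, mulr0).
Qed.

End Fourier.

Section Cayley.
Variables (R : realType) (F : finFieldType) (d : nat) (V : {set 'rV[F]_d}).

Lemma cayley_digraphE x y : cayley_digraph V x y = (y - x \in V).
Proof. by []. Qed.

(** The out-neighbours of [x] form the translate [x + V], the in-neighbours the reflected set
    [x - V]. *)
Lemma cayley_regular : regular_digraph (cayley_digraph V) #|V|.
Proof.
move=> x; split.
  rewrite -(card_imset V (addrI x)); apply: eq_card => y.
  rewrite inE cayley_digraphE; apply/idP/imsetP => [Vyx|[t Vt ->]].
    by exists (y - x); rewrite // addrC subrK.
  by rewrite addrC addKr.
rewrite -(card_imset V (subrI x)); apply: eq_card => y.
rewrite inE cayley_digraphE; apply/idP/imsetP => [Vxy|[t Vt ->]].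
  by exists (x - y); rewrite // subKr.
by rewrite subKr.
Qed.

(* The reflection [z |-> x + y - z] exchanges common in-neighbours and common
   out-neighbours of x and y. *)
Lemma cayley_normal (A := adjacency_mx R (cayley_digraph V)) :
  A^T *m A = A *m A^T.
Proof.
apply/matrixP => i j; rewrite !mxE.
pose x : 'rV[F]_d := enum_val i; pose y : 'rV[F]_d := enum_val j.
transitivity (\sum_z (x - z \in V)%:R * (y - z \in V)%:R : R[i]).
  by rewrite [RHS]sum_enum_val; apply: eq_bigr => k _; rewrite !mxE.
rewrite (reindex_inj (subrI (x + y))) [LHS]sum_enum_val.
apply: eq_bigr => k _; rewrite !mxE !cayley_digraphE mulrC -/x -/y.
by rewrite !opprB !(addrCA _ (enum_val k)) !opprD addNKr [- x - y]addrC addNKr.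
Qed.

Variable chi : F -> R[i].
Hypothesis chi_char : nontrivial_additive_character chi.

Lemma cayley_eigenvalue (z : R[i]) :
  z \in eigenvalues R (cayley_digraph V) ->
  exists m : 'rV[F]_d, z = \sum_(t in V) chi (dot m t).
Proof.
have [_ chiD _] := chi_char.
rewrite /eigenvalues; case: closed_field_poly_normal => s /= char_s s_z.
have : eigenvalue (adjacency_mx R (cayley_digraph V)) z.
  rewrite eigenvalue_root_char char_s (monicP (char_poly_monic _)) scale1r.
  by rewrite root_prod_XsubC.
case/eigenvalueP => v vA v_neq0.
pose f x := v 0 (enum_rank x).
(* Coordinate [y] of [v A = z v]: since [v] is a left eigenvector, the sum runs over the
   in-neighbours of [y]. *)
have fA y : \sum_(x | y - x \in V) f x = z * f y.
  move/matrixP/(_ 0 (enum_rank y)): vA; rewrite !mxE => <-.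
  rewrite big_mkcond [LHS]sum_enum_val.
  apply: eq_bigr => i _; rewrite mxE enum_rankK cayley_digraphE /f enum_valK.
  by case: (_ \in V); rewrite (mulr1, mulr0).
pose fhat m := \sum_y f y * chi (dot m y).
pose lam m := \sum_(t in V) chi (dot m t).
have fhatA m : z * fhat m = lam m * fhat m.
  rewrite /fhat mulr_sumr.
  under eq_bigr => y _ do rewrite mulrA -fA mulr_suml.
  rewrite (exchange_big_dep predT) //= mulr_sumr; apply: eq_bigr => x _.
  rewrite (reindex_inj (addIr x)) /lam mulr_suml.
  apply: eq_big => [t|t _]; first by rewrite addrK.
  by rewrite dotDr chiD mulrCA.
have [/existsP[m fm]|] := boolP [exists m, fhat m != 0].
  by exists m; apply: (mulIf fm).
rewrite negb_exists => /forallP fhat0.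
case/eqP: v_neq0; apply/rowP => i; rewrite mxE -(enum_valK i) -[LHS]/(f _).
apply/eqP; have := fourier_inversion chi_char f (enum_val i).
rewrite big1 => [|m _]; last first.
  by move/negPn/eqP: (fhat0 m); rewrite /fhat => ->; rewrite mulr0.
(* Inversion gives [q^d * f x = 0], and [q] is nonzero because [F] contains 0. *)
move/esym/eqP; rewrite mulf_eq0 expf_eq0 pnatr_eq0 => /orP[/andP[_]|//].
by move/eqP/card0_eq/(_ 0).
Qed.

End Cayley.

Section Modulus.
Variable R : realType.

Lemma modulusM : {morph @modulus R : x y / x * y}.
Proof. exact: ComplexField.Normc.normcM. Qed.

Lemma modulus_nat n : modulus n%:R = n%:R :> R.
Proof.
rewrite /modulus; have -> : n%:R = (n%:R)%:C%C :> R[i] by rewrite rmorph_nat.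
by rewrite /= expr0n addr0 sqrtr_sqr ger0_norm.
Qed.

End Modulus.

Lemma cayley_lambda_le (R : realType) (F : finFieldType) (d : nat) (C : R)
    (chi : F -> R[i]) (V : {set 'rV[F]_d}) :
  0 <= C -> nontrivial_additive_character chi ->
  (forall m : 'rV[F]_d, m != 0 ->
     modulus (fourier_indicator chi V m)
       <= C * #|F|%:R `^ (- ((d%:R + 1) / 2))) ->
  digraph_lambda R (cayley_digraph V) #|V| <= C * #|F|%:R `^ ((d%:R - 1) / 2).
Proof.
move=> C_ge0 chi_char V_le; have [chi0 _ _] := chi_char.
have q_gt0 : 0 < #|F|%:R :> R by rewrite ltr0n; apply/card_gt0P; exists 0.
rewrite /digraph_lambda big_seq_cond.
apply: bigmax_le => [|z /andP[/(cayley_eigenvalue chi_char)[m ->]]].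
  (* The default value 0 of the maximum must also satisfy the bound. *)
  by rewrite mulr_ge0 ?powR_ge0.
have [->|m_neq0] := eqVneq m 0.
  (* The trivial character gives the eigenvalue [#|V|], which the maximum excludes. *)
  under eq_bigr do rewrite dot0v chi0.
  by rewrite sumr_const modulus_nat eqxx.
move=> _; rewrite fourier_indicatorE modulusM -natrX modulus_nat natrX.
apply: le_trans (ler_wpM2l _ (V_le (- m) _)) _; rewrite ?exprn_ge0 ?oppr_eq0 //.
(* The factor [q^d] turns the decay [q^(-(d+1)/2)] into [q^((d-1)/2)]. *)
rewrite mulrCA -powR_mulrn // -powRD; last by rewrite (gt_eqF q_gt0) implybT.
have -> : d%:R - (d%:R + 1) / 2 = (d%:R - 1) / 2 :> R; last by [].
by rewrite !mulrDl {1}(splitr d%:R) opprD addrA addrK mulNr.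
Qed.

Theorem theorem4p1 (R : realType) (d : nat) (a b C : R)
    (a_gt0 : 0 < a) (b_gt0 : 0 < b) (C_gt0 : 0 < C) :
  exists c : R, 0 < c /\
    forall (F : finFieldType) (chi : F -> R[i]) (P : mpoly.mpoly d F),
      nontrivial_additive_character chi ->
      regular_variety a b C chi (variety P) ->
      nDl_digraph (cayley_digraph (variety P)) (#|F| ^ d)%N #|variety P|
        (c * #|F|%:R `^ ((d%:R - 1) / 2)).
Proof.
(* The constant of the Fourier bound serves as [c]; it is fixed before [F]. *)
exists C; split=> // F chi P chi_char [_ _ V_le]; split.
- by rewrite card_mx mul1n.
- exact: cayley_regular.
- exact: cayley_normal.
- by apply: cayley_lambda_le chi_char V_le; rewrite ltW.
Qed.
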